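(* Let $\alpha,\beta\ge1$ be real numbers, let $X>0$, and let $j\in\mathbb{Q}\setminus\{0,1728\}$. Then the set $\widetilde{\mathcal{E}}_j(X;H_{\alpha,\beta})$ of all elliptic curves $E_{A,B}:y^2=x^3+Ax+B$ with $A,B\in\mathbb{Z}$, $j(E_{A,B})=j$ and $H_{\alpha,\beta}(E_{A,B})\le X$ is described parametrically by $$\widetilde{\mathcal{E}}_j(X;H_{\alpha,\beta})=\left\{E_{A(j,m),B(j,m)} : m\in\mathbb{Z}\setminus\{0\},\ |m|\le c(j;H_{\alpha,\beta})X^{1/6}\right\},$$ where $A(j,m)$ and $B(j,m)$ are the integers defined by $$A(j,m)=\frac{N_{a(j)}^2m^2}{a(j)},\qquad B(j,m)=\frac{N_{a(j)}^3m^3}{a(j)},$$ and $$c(j;H_{\alpha,\beta}):=\min\left\{\frac{|a(j)|^{1/2}}{N_{a(j)}\alpha^{1/6}},\frac{|a(j)|^{1/3}}{N_{a(j)}\beta^{1/6}}\right\}.$$ This implies that $$\#\widetilde{\mathcal{E}}_j(X;H_{\alpha,\beta})=2\left\lfloor c(j;H_{\alpha,\beta})X^{1/6}\right\rfloor.$$ Moreover, for any $m\in\mathbb{Z}\setminus\{0\}$ and any prime $p$, $$2\operatorname{ord}_p(m)\le\operatorname{ord}_p(A(j,m))\le2\operatorname{ord}_p(m)+1\quad\text{if }\operatorname{ord}_p(a(j))\ge0,$$ $$3\operatorname{ord}_p(m)\le\operatorname{ord}_p(B(j,m))\le3\operatorname{ord}_p(m)+2\quad\text{if }\operatorname{ord}_p(a(j))<0.$$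 In particular, $E_{A(j,m),B(j,m)}\in\mathcal{E}_j(X;H_{\alpha,\beta})$ if and only if $m$ is square-free and $|m|\le c(j;H_{\alpha,\beta})X^{1/6}$; in other words, $$\mathcal{E}_j(X;H_{\alpha,\beta})=\left\{E_{A(j,m),B(j,m)} : m\in\mathbb{Z}\setminus\{0\}\text{ is square-free and }|m|\le c(j;H_{\alpha,\beta})X^{1/6}\right\}.$$
   Context: For $(A,B)\in\mathbb{Z}^2$ let $E_{A,B}$ denote the curve $y^2=x^3+Ax+B$; curves are identified with their pairs $(A,B)$. Let $\widetilde{\mathcal{E}}$ be the set of all $E_{A,B}$ with $A,B\in\mathbb{Z}$ and $-16(4A^3+27B^2)\neq 0$, and let $\mathcal{E}$ be the set of $E_{A,B}\in\widetilde{\mathcal{E}}$ such that there is no prime $p$ with $p^4\mid A$ and $p^6\mid B$. The $j$-invariant is $j(E_{A,B})=1728\cdot\frac{4A^3}{4A^3+27B^2}$. For $j\in\mathbb{Q}$, $\widetilde{\mathcal{E}}_j:=\{E_{A,B}\in\widetilde{\mathcal{E}}: j(E_{A,B})=j\}$ and $\mathcal{E}_j:=\{E_{A,B}\in\mathcal{E}: j(E_{A,B})=j\}$. For real $\alpha,\beta\ge1$, $H_{\alpha,\beta}(E_{A,B}):=\max\{\alpha|A|^3,\beta B^2\}$, and for a family $\mathcal{F}$ and $X>0$, $\mathcal{F}(X;H_{\alpha,\beta}):=\{E_{A,B}\in\mathcal{F}: H_{\alpha,\beta}(E_{A,B})\le X\}$. For $a\in\mathbb{Q}^\times$ and a prime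 $p$, let $\alpha_p(a):=\lceil \operatorname{ord}_p(a)/2\rceil$ if $\operatorname{ord}_p(a)\ge0$ and $\alpha_p(a):=\lceil\operatorname{ord}_p(a)/3\rceil$ if $\operatorname{ord}_p(a)<0$, where $\operatorname{ord}_p$ is the $p$-adic valuation; let $N_a:=\prod_p p^{\alpha_p(a)}\in\mathbb{Q}^\times$ (product over all primes). For $j\in\mathbb{Q}\setminus\{0,1728\}$ let $a(j):=\frac{4(1728-j)}{27j}\in\mathbb{Q}^\times$. *)

(* Defs.v *)
From mathcomp Require Import all_boot all_order all_algebra finmap.
From mathcomp Require Import boolp classical_sets functions cardinality fsbigop.
From mathcomp Require Import reals exp.
Set Implicit Arguments.
Unset Strict Implicit.
Unset Printing Implicit Defensive.
Import Order.TTheory GRing.Theory Num.Theory.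
Local Open Scope classical_set_scope.
Local Open Scope ring_scope.

(* The pair (A, B) stands for the curve y^2 = x^3 + A x + B. *)
Definition curve : Type := (int * int)%type.

Definition disc (E : curve) : int :=
  - 16 * (4 * E.1 ^+ 3 + 27 * E.2 ^+ 2).

Definition jinv (E : curve) : rat :=
  1728 * ((4 * E.1 ^+ 3)%:~R / (4 * E.1 ^+ 3 + 27 * E.2 ^+ 2)%:~R).

Definition all_curves : set curve := [set E | disc E != 0].

Definition min_curves : set curve :=
  [set E | all_curves E /\
    ~ exists p : nat, [/\ prime p, (p%:Z ^+ 4 %| E.1)%Z & (p%:Z ^+ 6 %| E.2)%Z]].

Definition with_j (F : set curve) (j : rat) : set curve :=
  [set E | F E /\ jinv E = j].

Definition height (R : realType) (alpha beta : R) (E : curve) : R :=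
  Num.max (alpha * `|E.1%:~R| ^+ 3) (beta * E.2%:~R ^+ 2).

Definition height_le (R : realType) (F : set curve) (alpha beta X : R) :
  set curve := [set E | F E /\ height alpha beta E <= X].

(* p-adic valuation; the value at x = 0, meant to be infinite, is here 0. *)
Definition ordp (p : nat) (x : rat) : int :=
  (logn p `|numq x|%N)%:Z - (logn p `|denq x|%N)%:Z.

Definition alphap (p : nat) (a : rat) : int :=
  if 0 <= ordp p a then Num.ceil ((ordp p a)%:~R / 2 : rat)
  else Num.ceil ((ordp p a)%:~R / 3 : rat).

(* Finitely supported product: for a != 0, almost all factors are 1. *)
Definition Na (a : rat) : rat :=
  \big[*%R/1]_(p \in [set p : nat | prime p]) (p%:R : rat) ^ alphap p a.

Definition aj (j : rat) : rat := 4 * (1728 - j) / (27 * j).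

Definition Aq (j : rat) (m : int) : rat := Na (aj j) ^+ 2 * m%:~R ^+ 2 / aj j.
Definition Bq (j : rat) (m : int) : rat := Na (aj j) ^+ 3 * m%:~R ^+ 3 / aj j.

(* Integer versions of Aq and Bq: the floor is there only for typing, the
   integrality of Aq and Bq has to be asserted separately. *)
Definition Aj (j : rat) (m : int) : int := Num.floor (Aq j m).
Definition Bj (j : rat) (m : int) : int := Num.floor (Bq j m).

Definition curvej (j : rat) (m : int) : curve := (Aj j m, Bj j m).

Definition cj (R : realType) (j : rat) (alpha beta : R) : R :=
  Num.min
    (`|ratr (aj j)| `^ (1 / 2) / (ratr (Na (aj j)) * alpha `^ (1 / 6)))
    (`|ratr (aj j)| `^ (1 / 3) / (ratr (Na (aj j)) * beta `^ (1 / 6))).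

Definition squarefree (m : int) : Prop :=
  forall d : int, (d ^+ 2 %| m)%Z -> `|d| = 1.

(* Main.v *)
(* Fixing j amounts to fixing a = B^2 / A^3.  With t = B / A one has A = t^2 / a
   and B = t^3 / a, so the curve is integral iff, for every prime p,
   2 ord_p t >= ord_p a and 3 ord_p t >= ord_p a; the binding condition is the
   first one if ord_p a >= 0 and the second one otherwise, so that together they
   say t = N_a m with m an integer.  The height bounds are then bounds on |m|,
   and p^4 | A, p^6 | B hold together iff p^2 | m. *)
Require Import Defs.
From mathcomp Require Import all_boot all_order all_algebra finmap.
From mathcomp Require Import boolp classical_sets functions cardinality fsbigop.
From mathcomp Require Import reals exp.
From mathcomp Require Import zify ring lra.
Import Order.TTheory GRing.Theory Num.Theory.
Local Open Scope classical_set_scope.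
Local Open Scope ring_scope.

(** * p-adic valuations on the rationals *)

Lemma ordp_frac (p : nat) (n d : int) : n != 0 -> d != 0 ->
  ordp p (n%:~R / d%:~R) = (logn p `|n|%N)%:Z - (logn p `|d|%N)%:Z.
Proof.
move=> n0 d0; set x := _ / _.
have x0 : x != 0 by rewrite mulf_neq0 ?invr_eq0 ?intr_eq0.
(* The fraction n/d need not be reduced, so valuations are compared after cross-multiplying with its
   reduced form. *)
have E : (numq x * d)%R = (n * denq x)%R.
  apply/eqP; rewrite -(eqr_int rat) !rmorphM /= numqE /x; apply/eqP.
  by rewrite mulrAC divfK ?intr_eq0.
have := congr1 (fun z : int => logn p `|z|%N) E.
rewrite !abszM !lognM ?absz_gt0 ?numq_eq0 ?denq_eq0 //.
by rewrite /ordp; lia.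
Qed.

Lemma ordp_int (p : nat) (n : int) : ordp p n%:~R = (logn p `|n|%N)%:Z.
Proof. by rewrite /ordp numq_int denq_int /= logn1 subr0. Qed.

Lemma ordp1 (p : nat) : ordp p 1 = 0.
Proof. by have := ordp_int p 1; rewrite /= logn1. Qed.

Lemma ordpM (p : nat) (x y : rat) : x != 0 -> y != 0 ->
  ordp p (x * y) = ordp p x + ordp p y.
Proof.
move=> x0 y0.
have -> : x * y = (numq x * numq y)%:~R / (denq x * denq y)%:~R.
  by rewrite -{1}(divq_num_den x) -{1}(divq_num_den y) !rmorphM /= mulf_div.
rewrite ordp_frac ?mulf_neq0 ?numq_eq0 ?denq_eq0 //.
rewrite !abszM !lognM ?absz_gt0 ?numq_eq0 ?denq_eq0 //.
by rewrite /ordp; lia.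
Qed.

Lemma ordpV (p : nat) (x : rat) : x != 0 -> ordp p x^-1 = - ordp p x.
Proof.
move=> x0; have := ordpM p x x^-1 x0; rewrite invr_eq0 mulfV // ordp1.
by move=> /(_ x0); lia.
Qed.

Lemma ordpX (p n : nat) (x : rat) : x != 0 -> ordp p (x ^+ n) = n%:Z * ordp p x.
Proof.
move=> x0; elim: n => [|n IHn]; first by rewrite expr0 ordp1 mul0r.
by rewrite exprS ordpM ?expf_neq0 // IHn; lia.
Qed.

Lemma ordpXz (p : nat) (x : rat) (n : int) : x != 0 ->
  ordp p (x ^ n) = n * ordp p x.
Proof.
move=> x0; case: n => n; first exact: ordpX.
by rewrite NegzE -exprnN ordpV ?expf_neq0 // ordpX // mulNr.
Qed.

Lemma ordp_prime (p q : nat) : prime p -> prime q ->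
  ordp p q%:R = (p == q)%:R.
Proof.
move=> pp pq; rewrite -[q%:R]/(q%:Z%:~R) ordp_int /= logn_prime //.
by case: eqP.
Qed.

Lemma logn_gt_eq0 (p n : nat) : (n < p)%N -> logn p n = 0%N.
Proof.
move=> ltnp; apply/eqP; rewrite -leqn0 leqNgt; apply/negP => lt0.
have n0 : (0 < n)%N by move: lt0; rewrite logn_gt0 mem_primes => /and3P[].
have := dvdn_leq n0 (pfactor_dvdnn p n).
have := leq_pexp2l (leq_ltn_trans (leq0n n) ltnp) lt0.
by rewrite expn1; lia.
Qed.

Lemma ordp_gt_eq0 (p : nat) (x : rat) :
  (`|numq x| + `|denq x| < p)%N -> ordp p x = 0.
Proof. by move=> ltp; rewrite /ordp !logn_gt_eq0 //; lia. Qed.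

(** A prime factor of the reduced denominator is coprime to the numerator, so the valuation there
    would be negative. *)
Lemma ordp_ge0_int (x : rat) :
  (forall p, prime p -> 0 <= ordp p x) -> x \is a Num.int.
Proof.
move=> h; rewrite Qint_def; apply: contraT => d1.
have [|p pp pd] := @pdivP `|denq x|%N; first by move: d1 (denq_gt0 x); lia.
have pn : logn p `|numq x|%N = 0%N.
  apply: logn_coprime; apply: coprime_dvdl pd _.
  by rewrite coprime_sym coprime_num_den.
have : (0 < logn p `|denq x|)%N by rewrite logn_gt0 mem_primes pp pd absz_gt0 denq_neq0.
by move: (h p pp); rewrite /ordp pn; lia.
Qed.

(** * The exponents [alphap] and the number [Na] *)

Lemma alphap_ge0 (p : nat) (a : rat) : 0 <= ordp p a ->
  ordp p a <= 2 * alphap p a <= ordp p a + 1.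
Proof.
move=> a0; rewrite /alphap a0.
have /andP[] := ceil_itv ((ordp p a)%:~R / 2 : rat).
move: (Num.ceil _) => c.
(* The strict bound c - 1 < ord/2 becomes 2c <= ord + 1 over the integers, which leaves linear
   arithmetic for all later uses. *)
rewrite ltr_pdivlMr ?ler_pdivrMr // -[2]/(2%:~R) -!intrM ltr_int ler_int.
lia.
Qed.

Lemma alphap_lt0 (p : nat) (a : rat) : ordp p a < 0 ->
  ordp p a <= 3 * alphap p a <= ordp p a + 2.
Proof.
move=> a0; rewrite /alphap (lt_geF a0).
have /andP[] := ceil_itv ((ordp p a)%:~R / 3 : rat).
move: (Num.ceil _) => c.
rewrite ltr_pdivlMr ?ler_pdivrMr // -[3]/(3%:~R) -!intrM ltr_int ler_int.
lia.
Qed.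

(** A prime larger than |numerator| + |denominator| divides neither, so its exponent is 0. This
    makes the product defining [Na] a finite one. *)
Lemma Na_support (a : rat) :
  [set p : nat | prime p] `&`
    (fun p : nat => (p%:R : rat) ^ alphap p a) @^-1` [set~ 1]
  `<=` `I_(`|numq a| + `|denq a|).+1.
Proof.
move=> p [_ /= h]; rewrite ltnNge; apply/negP => lep; apply: h.
by rewrite /alphap ordp_gt_eq0 // lexx mul0r ceil0 expr0z.
Qed.

Lemma Na_prod (a : rat) : let n := (`|numq a| + `|denq a|).+1 in
  Na a = \prod_(i < n | prime i) (i%:R : rat) ^ alphap i a.
Proof.
move=> n; rewrite /Na.
(* The factors at primes outside [I_n] equal 1, so the index set shrinks to the primes below n. *)
rewrite -(@fsbig_widen _ _ _ _ ([set p : nat | prime p] `&` `I_n)); last 2 first.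
- by apply: subIsetl.
- move=> p /= [pp np]; apply/eqP; apply/negPn/negP => /eqP h; apply: np; split=> //.
  by apply: (Na_support a); split.
rewrite fsbig_mkcondl.
rewrite -(fsbig_ord *%R n (fun p => if p \in [set p : nat | prime p] then _ else 1)) [RHS]big_mkcond /=.
by apply: eq_bigr => i _; rewrite /patch mem_setE.
Qed.

Lemma Na_gt0 (a : rat) : 0 < Na a.
Proof.
rewrite Na_prod; apply: prodr_gt0 => i pi.
by rewrite exprz_gt0 // ltr0n prime_gt0.
Qed.

Lemma ordp_prod (I : Type) (p : nat) (r : seq I) (P : pred I) (F : I -> rat) :
  (forall i, P i -> F i != 0) ->
  ordp p (\prod_(i <- r | P i) F i) = \sum_(i <- r | P i) ordp p (F i).
Proof.
(* Nonvanishing of the partial products is carried through the induction, since [ordpM] requires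
   it. *)
move=> F0; suff [] : \prod_(i <- r | P i) F i != 0 /\
  ordp p (\prod_(i <- r | P i) F i) = \sum_(i <- r | P i) ordp p (F i) by [].
apply: (big_rec2 (fun x s => x != 0 /\ ordp p x = s)); first by rewrite ordp1.
by move=> i x s Pi [x0 <-]; rewrite mulf_neq0 ?ordpM ?F0.
Qed.

Lemma ordp_Na (p : nat) (a : rat) : prime p -> ordp p (Na a) = alphap p a.
Proof.
move=> pp; have p0 q : prime q -> (q%:R : rat) != 0.
  by move=> /prime_gt0; rewrite pnatr_eq0 lt0n.
rewrite Na_prod ordp_prod => [|q pq]; last by rewrite expfz_neq0 ?p0.
under eq_bigr => q pq do rewrite ordpXz ?p0 // ordp_prime //.
(* If p is in the range, only its own factor contributes; otherwise the sum is 0, and so is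
   [alphap p a]. *)
have [ltp|lep] := ltnP p (`|numq a| + `|denq a|).+1.
  rewrite (bigD1 (Ordinal ltp)) //= eqxx mulr1 big1 ?addr0 // => q /andP[_ qp].
  by rewrite -val_eqE /= eq_sym in qp; rewrite (negbTE qp) mulr0.
rewrite big1 => [|q _]; last by rewrite gtn_eqF ?mulr0 // (leq_trans _ lep).
by rewrite /alphap ordp_gt_eq0 // lexx mul0r ceil0.
Qed.

(** * The j-invariant condition as an equation B^2 = a A^3 *)

Lemma aj_neq0 (j : rat) : j != 0 -> j != 1728 -> aj j != 0.
Proof.
rewrite /aj; move: (1728 : rat) => c j0 j1.
apply: mulf_neq0; first by apply: mulf_neq0; rewrite ?pnatr_eq0 // subr_eq0 eq_sym.
by rewrite invr_eq0; apply: mulf_neq0; rewrite ?pnatr_eq0.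
Qed.

(** Clearing denominators in j(E) = j gives 27 j B^2 = 4 (1728 - j) A^3, and A = 0 would force j =
    0. Conversely, substituting B^2 = a A^3 turns 4 A^3 + 27 B^2 into 4 * 1728 * A^3 / j, which is
    nonzero. *)
Lemma with_jP (j : rat) (E : curve) : j != 0 -> j != 1728 ->
  with_j all_curves j E <->
  E.1 != 0 /\ (E.2%:~R ^+ 2 = aj j * E.1%:~R ^+ 3 :> rat).
Proof.
have : (1728 : rat) != 0 by rewrite pnatr_eq0.
(* The only numerical fact about 1728 that enters is that it is nonzero, so it is made a
   variable. *)
rewrite /with_j /all_curves /disc /jinv /aj; move: (1728 : rat) => c c0 j0 j1.
case: E => A B /=; rewrite mulf_eq0 /=.
rewrite -(intr_eq0 rat (4 * _ + _)) -(intr_eq0 rat A) rmorphD !(rmorphXn, rmorphM) /=.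
rewrite -[4%:~R]/(4 : rat) -[27%:~R]/(27 : rat).
move: (A%:~R : rat) (B%:~R : rat) => x y.
have n4 : (4 : rat) != 0 by rewrite pnatr_eq0.
have n27j : 27 * j != 0 by apply: mulf_neq0; rewrite ?pnatr_eq0.
split.
  move=> [D0 jE]; have x0 : x != 0.
    by apply/eqP => x0; move: j0; rewrite -jE x0 expr0n /= mulr0 mul0r mulr0 eqxx.
  split=> //; have jD : j * (4 * x ^+ 3 + 27 * y ^+ 2) = c * (4 * x ^+ 3).
    rewrite -jE; move: (4 * x ^+ 3 + _) D0 => D D0; move: (4 * _) => u.
    by rewrite -mulrA divfK.
  apply: (mulfI n27j).
  have -> : 27 * j * (4 * (c - j) / (27 * j) * x ^+ 3) = 4 * (c - j) * x ^+ 3.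
    by field.
  by move: jD; rewrite mulrDr; move: (x ^+ 3) (y ^+ 2) => u v; lra.
move=> [x0 yE]; have x30 : x ^+ 3 != 0 by rewrite expf_neq0.
have -> : 4 * x ^+ 3 + 27 * y ^+ 2 = 4 * c * x ^+ 3 / j by rewrite yE; field.
have j0' : j^-1 != 0 by rewrite invr_eq0.
split; first exact: (mulf_neq0 (mulf_neq0 (mulf_neq0 n4 c0) x30) j0').
by field; rewrite ?x0 ?c0 ?j0.
Qed.

(** * The parametrization: integrality, surjectivity, injectivity *)

Lemma Na_neq0 (a : rat) : Na a != 0.
Proof. by rewrite gt_eqF ?Na_gt0. Qed.

(* [curvej j m] is convertible to [twist (aj j) m]. *)
Definition twist (a : rat) (m : int) : curve :=
  (Num.floor (Na a ^+ 2 * m%:~R ^+ 2 / a), Num.floor (Na a ^+ 3 * m%:~R ^+ 3 / a)).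

Lemma ordp_scaled (n : nat) (a : rat) (m : int) (p : nat) :
  a != 0 -> m != 0 -> prime p ->
  ordp p (Na a ^+ n * m%:~R ^+ n / a) =
    n%:Z * alphap p a + n%:Z * ordp p m%:~R - ordp p a.
Proof.
move=> a0 m0 pp; rewrite -(ordp_Na p a pp).
have := Na_neq0 a; move: (Na a) => N N0.
have m0' : (m%:~R : rat) != 0 by rewrite intr_eq0.
rewrite ordpM ?invr_eq0 ?mulf_neq0 ?expf_neq0 // ordpV // ordpM ?expf_neq0 //.
by rewrite !ordpX.
Qed.

Lemma scaled_neq0 (n : nat) (a : rat) (m : int) :
  a != 0 -> m != 0 -> Na a ^+ n * m%:~R ^+ n / a != 0.
Proof.
move=> a0; rewrite -(intr_eq0 rat) => m0; have := Na_neq0 a; move: (Na a) => N N0.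
by rewrite !mulf_neq0 ?invr_eq0 ?expf_neq0.
Qed.

(** The floor changes nothing, because 2 alpha_p >= ord_p a at every prime: if ord_p a < 0, then 3
    alpha_p >= ord_p a still yields 2 alpha_p >= (2/3) ord_p a >= ord_p a. The argument for [twistB]
    is symmetric. *)
Lemma twistA (a : rat) (m : int) : a != 0 -> m != 0 ->
  (twist a m).1%:~R = Na a ^+ 2 * m%:~R ^+ 2 / a.
Proof.
move=> a0 m0; apply: floorK; apply: ordp_ge0_int => p pp.
rewrite ordp_scaled // ordp_int.
by case: (ltP (ordp p a) 0) => [/[dup]/alphap_lt0|/[dup]/alphap_ge0]; lia.
Qed.

Lemma twistB (a : rat) (m : int) : a != 0 -> m != 0 ->
  (twist a m).2%:~R = Na a ^+ 3 * m%:~R ^+ 3 / a.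
Proof.
move=> a0 m0; apply: floorK; apply: ordp_ge0_int => p pp.
rewrite ordp_scaled // ordp_int.
by case: (ltP (ordp p a) 0) => [/[dup]/alphap_lt0|/[dup]/alphap_ge0]; lia.
Qed.

Lemma twistA_neq0 (a : rat) (m : int) : a != 0 -> m != 0 -> (twist a m).1 != 0.
Proof. by move=> a0 m0; rewrite -(intr_eq0 rat) twistA // scaled_neq0. Qed.

Lemma twistB_neq0 (a : rat) (m : int) : a != 0 -> m != 0 -> (twist a m).2 != 0.
Proof. by move=> a0 m0; rewrite -(intr_eq0 rat) twistB // scaled_neq0. Qed.

Lemma twist_eq (a : rat) (m : int) : a != 0 -> m != 0 ->
  (twist a m).2%:~R ^+ 2 = a * (twist a m).1%:~R ^+ 3 :> rat.
Proof.
move=> a0 m0; rewrite twistA // twistB //.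
by move: (Na a) (m%:~R) => N x; field.
Qed.

Lemma twist_surj (a : rat) (E : curve) : a != 0 -> E.1 != 0 ->
  E.2%:~R ^+ 2 = a * E.1%:~R ^+ 3 :> rat -> exists2 m : int, m != 0 & twist a m = E.
Proof.
case: E => A B /= a0 A0 BA; have N0 := Na_neq0 a.
have Aq0 : (A%:~R : rat) != 0 by rewrite intr_eq0.
have B0 : B != 0.
  rewrite -(intr_eq0 rat); apply/eqP => B0; move/eqP: BA.
  by rewrite B0 expr0n /= eq_sym mulf_eq0 (negbTE a0) expf_eq0 (negbTE Aq0).
have Bq0 : (B%:~R : rat) != 0 by rewrite intr_eq0.
have [t tdef] : exists t : rat, t = B%:~R / A%:~R by eexists.
have t0 : t != 0 by rewrite tdef mulf_neq0 ?invr_eq0.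
have tA : t ^+ 2 = a * A%:~R by rewrite tdef expr_div_n BA; field.
have tB : t ^+ 3 = a * B%:~R by rewrite exprS tA tdef; field.
(* Since A and B are integers, 2 ord t >= ord a and 3 ord t >= ord a. As ord t is an integer, the
   inequality matching the sign of ord a rounds up to ord t >= alpha_p. *)
have /intrP[m mE] : t / Na a \is a Num.int.
  apply: ordp_ge0_int => p pp; rewrite ordpM ?invr_eq0 // ordpV // ordp_Na //.
  have := congr1 (ordp p) tA; have := congr1 (ordp p) tB.
  rewrite !ordpX // !ordpM // !ordp_int.
  by case: (ltP (ordp p a) 0) => [/[dup]/alphap_lt0|/[dup]/alphap_ge0]; lia.
have m0 : m != 0 by rewrite -(intr_eq0 rat) -mE mulf_neq0 ?invr_eq0.
have tE : t = Na a * m%:~R by rewrite -mE mulrC divfK.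
have fA := twistA a m a0 m0; have fB := twistB a m a0 m0.
rewrite -exprMn -tE tA mulrC mulKf // in fA.
rewrite -exprMn -tE tB mulrC mulKf // in fB.
by exists m => //; move: fA fB; case: (twist a m) => A' B' /= /intr_inj-> /intr_inj->.
Qed.

(** The parameter is recovered from the curve, as B / A = N_a m. *)
Lemma twist_inj (a : rat) (m n : int) : a != 0 -> m != 0 -> n != 0 ->
  twist a m = twist a n -> m = n.
Proof.
move=> a0 m0 n0 E; have N0 := Na_neq0 a; apply: (@intr_inj rat).
have Bt k : k != 0 -> (twist a k).2%:~R / (twist a k).1%:~R = Na a * k%:~R.
  move=> k0; rewrite twistA // twistB //; move: k0; rewrite -(intr_eq0 rat).
  move: (Na a) N0 (k%:~R) => N N0 x x0; field.
  by rewrite N0 a0 x0.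
by apply: (mulfI N0); rewrite -!Bt // E.
Qed.

(** * Square-free parameters and minimal curves *)

Lemma squarefree_logn (m : int) : m != 0 ->
  squarefree m <-> forall p, prime p -> (logn p `|m| <= 1)%N.
Proof.
move=> m0; have m0' : (0 < `|m|)%N by rewrite absz_gt0.
split=> [sf p pp|sf d].
  rewrite leqNgt; apply/negP => l2; have : `|p%:Z| = 1.
    by apply: sf; rewrite dvdzE abszX /= pfactor_dvdn.
  by move: (prime_gt1 pp); lia.
rewrite dvdzE abszX => dm; apply: contrapT => d1.
have [|p pp pd] := @pdivP `|d|%N.
  (* A divisor with |d| != 1 has a prime factor once d = 0 is excluded; 0 does not divide the
     nonzero m. *)
  have : `|d|%N != 0%N.
    by apply/eqP => d0; move: dm; rewrite d0 exp0n // dvd0n; lia.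
  by lia.
have := sf p pp; rewrite leqNgt -pfactor_dvdn // (dvdn_trans _ dm) //.
by rewrite dvdn_exp2r.
Qed.

Lemma twist_min (a : rat) (m : int) : a != 0 -> m != 0 ->
  ~ (exists p : nat, [/\ prime p, (p%:Z ^+ 4 %| (twist a m).1)%Z
                                & (p%:Z ^+ 6 %| (twist a m).2)%Z])
  <-> squarefree m.
Proof.
move=> a0 m0.
have ge4 p : prime p -> (p%:Z ^+ 4 %| (twist a m).1)%Z =
    (4 <= 2 * alphap p a + 2 * (logn p `|m|)%:Z - ordp p a).
  move=> pp; rewrite -ordp_int -(ordp_scaled 2 a m p) // -twistA // ordp_int.
  by rewrite dvdzE abszX pfactor_dvdn // absz_gt0 twistA_neq0.
have ge6 p : prime p -> (p%:Z ^+ 6 %| (twist a m).2)%Z =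
    (6 <= 3 * alphap p a + 3 * (logn p `|m|)%:Z - ordp p a).
  move=> pp; rewrite -ordp_int -(ordp_scaled 3 a m p) // -twistB // ordp_int.
  by rewrite dvdzE abszX pfactor_dvdn // absz_gt0 twistB_neq0.
(* Let l = ord_p m. If ord_p a >= 0, then 2 alpha_p - ord_p a is 0 or 1, so p^4 divides A exactly
   when l >= 2, and then p^6 divides B too. If ord_p a < 0, then 3 alpha_p - ord_p a is 0, 1 or 2,
   and A and B exchange roles. *)
have key p : prime p ->
    ((p%:Z ^+ 4 %| (twist a m).1)%Z && (p%:Z ^+ 6 %| (twist a m).2)%Z)
    = (1 < logn p `|m|)%N.
  move=> pp; rewrite ge4 // ge6 //.
  by case: (ltP (ordp p a) 0) => [/[dup]/alphap_lt0|/[dup]/alphap_ge0]; lia.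
rewrite squarefree_logn //; split=> [nE p pp|sf [p [pp h4 h6]]].
  rewrite leqNgt; apply/negP => l2; apply: nE; exists p.
  by move: l2; rewrite -key // => /andP[].
by have := sf p pp; rewrite leqNgt -key // h4 h6.
Qed.

(** * Height bounds as bounds on |m| *)

Lemma powR_exp (R : realType) (x r : R) (n : nat) : 0 <= x -> r * n%:R = 1 ->
  (x `^ r) ^+ n = x.
Proof.
by move=> x0 rn; rewrite -powR_mulrn ?powR_ge0 // -powRrM rn powRr1.
Qed.

(** Both sides of the first inequality are nonnegative, so it may be raised to the sixth power. It
    serves with x = |m|, s = |a|, N = N_a, and with k = 3 for the A-term, k = 2 for the B-term of
    the height. *)
Lemma ler_root6 (R : realType) (x s N c X r : R) (k : nat) :
  0 <= x -> 0 < s -> 0 < N -> 0 < c -> 0 < X -> r * 6 = k%:R ->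
  (x <= s `^ r / (N * c `^ (1 / 6)) * X `^ (1 / 6)) =
  (c * (N ^+ 6 * x ^+ 6 / s ^+ k) <= X).
Proof.
move=> x0 s0 N0 c0 X0 rk; set y := _ * _ `^ _.
have y0 : 0 <= y by rewrite !mulr_ge0 ?invr_ge0 ?mulr_ge0 ?powR_ge0 ?ltW.
have h6 : (1 / 6 : R) * 6%:R = 1 by field.
have -> : (x <= y) = (x ^+ 6 <= y ^+ 6) by rewrite ler_pXn2r.
have -> : y ^+ 6 = s ^+ k * X / (N ^+ 6 * c).
  rewrite /y !exprMn exprVn !exprMn !(powR_exp _ _ (1 / 6) 6) ?(ltW c0) ?(ltW X0) //.
  by rewrite -(powR_mulrn 6 (powR_ge0 s r)) -powRrM rk powR_mulrn ?ltW // mulrAC.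
have Nc : 0 < N ^+ 6 * c by rewrite mulr_gt0 ?exprn_gt0.
have sk : 0 < s ^+ k by rewrite exprn_gt0.
rewrite ler_pdivlMr // mulrA ler_pdivrMr // [X * _]mulrC.
by congr (_ <= _); ring.
Qed.

Lemma twist_height (R : realType) (alpha beta X : R) (a : rat) (m : int) :
  0 < alpha -> 0 < beta -> 0 < X -> a != 0 -> m != 0 ->
  (height alpha beta (twist a m) <= X) =
  (`|m%:~R| <= Num.min
    (`|ratr a| `^ (1 / 2) / (ratr (Na a) * alpha `^ (1 / 6)))
    (`|ratr a| `^ (1 / 3) / (ratr (Na a) * beta `^ (1 / 6))) * X `^ (1 / 6)).
Proof.
move=> al0 be0 X0 a0 m0.
have s0 : 0 < `|ratr a : R| by rewrite normr_gt0 fmorph_eq0.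
have N0 : 0 < ratr (Na a) :> R by rewrite ltr0q Na_gt0.
have Ae : `|(twist a m).1%:~R : R| ^+ 3 =
    ratr (Na a) ^+ 6 * `|m%:~R| ^+ 6 / `|ratr a| ^+ 3.
  rewrite -ratr_int twistA // fmorph_div rmorphM !rmorphXn /= ratr_int.
  rewrite normrM normrV ?unitfE ?fmorph_eq0 // normrM !normrX (gtr0_norm N0).
  by move: s0 => /lt0r_neq0 s0; field.
have Be : (twist a m).2%:~R ^+ 2 =
    ratr (Na a) ^+ 6 * `|m%:~R| ^+ 6 / `|ratr a| ^+ 2 :> R.
  (* B^2 is rewritten as |B|^2, so that absolute values distribute as they do for A. *)
  rewrite -(real_normK (num_real _)) -ratr_int twistB // fmorph_div rmorphM !rmorphXn /= ratr_int.
  rewrite normrM normrV ?unitfE ?fmorph_eq0 // normrM !normrX (gtr0_norm N0).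
  by move: s0 => /lt0r_neq0 s0; field.
rewrite /height ge_max Ae Be minr_pMl ?powR_ge0 // le_min.
rewrite (ler_root6 _ _ _ _ _ _ _ 3) //; last by field.
by rewrite (ler_root6 _ _ _ _ _ _ _ 2) //; last by field.
Qed.

(** * Counting the curves *)

Lemma card_inj_nonzero (T : choiceType) (f : int -> T) (n : nat) (S : set T) :
  (forall k l : int, k != 0 -> l != 0 -> f k = f l -> k = l) ->
  S = [set f m | m in [set m : int | m != 0 /\ (`|m| <= n)%N]] ->
  finite_set S /\ #|` fset_set S|%fset = (2 * n)%N.
Proof.
move=> finj ->.
(* An explicit duplicate-free list of the nonzero integers in [-n, n]: first 1, ..., n, then their
   negatives. *)
pose s := [seq i.+1%:Z | i <- iota 0 n] ++ [seq - i.+1%:Z | i <- iota 0 n].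
have sE k : (k \in s) = (k != 0) && (`|k| <= n)%N.
  rewrite mem_cat; apply/orP/andP => [[]/mapP[i]|[k0 kn]].
  - by rewrite mem_iota => /= h ->; split; lia.
  - by rewrite mem_iota => /= h ->; split; lia.
  - case: (ltP 0 k) => hk; [left|right]; apply/mapP; exists (`|k|.-1)%N;
      rewrite ?mem_iota; lia.
have us : uniq s.
  rewrite cat_uniq !map_inj_uniq ?iota_uniq; last 2 first.
  - by move=> x y; lia.
  - by move=> x y; lia.
  rewrite andbT /=; apply/hasPn => _ /mapP[i _ ->]; apply/mapP => -[k _]; lia.
have ufs : uniq (map f s).
  rewrite map_inj_in_uniq // => k l; rewrite !sE => /andP[k0 _] /andP[l0 _].
  exact: finj.
have -> : [set f m | m in [set m : int | m != 0 /\ (`|m| <= n)%N]] =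
    [set` seq_fset tt (map f s)].
  apply/seteqP; split=> x.
    move=> [m [m0 mn] <-]; suff : f m \in map f s by rewrite -(seq_fsetE tt).
    by apply: map_f; rewrite sE m0 mn.
  rewrite -[X in X -> _]/(is_true (x \in seq_fset tt (map f s))) seq_fsetE.
  by move=> /mapP[m]; rewrite sE => /andP[m0 mn] ->; exists m.
split; first exact: finite_fset.
rewrite set_fsetK size_seq_fset undup_id // size_map size_cat !size_map size_iota.
by rewrite mul2n addnn.
Qed.

(** For y >= 0 the floor is nonnegative, so its [absz] is the floor itself. *)
Lemma ler_absz_floor (R : realType) (m : int) (y : R) : 0 <= y ->
  (`|m%:~R| <= y) = (`|m| <= `|Num.floor y|)%N.
Proof.
move=> y0; rewrite -intr_norm -floor_ge_int.
by move: y0; rewrite -floor_ge0; move: (Num.floor y) => n; lia.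
Qed.

Lemma min_root_ge0 (R : realType) (s N c d r t X : R) : 0 <= N ->
  0 <= Num.min (s `^ r / (N * c `^ (1 / 6))) (s `^ t / (N * d `^ (1 / 6))) *
       X `^ (1 / 6).
Proof.
by move=> N0; rewrite mulr_ge0 ?powR_ge0 // le_min !divr_ge0 ?mulr_ge0 ?powR_ge0.
Qed.

(** The excess over 2 ord_p m, respectively 3 ord_p m, is the rounding error 2 alpha_p - ord_p a,
    respectively 3 alpha_p - ord_p a. *)
Lemma twist_ordp (a : rat) (m : int) (p : nat) :
  a != 0 -> m != 0 -> prime p ->
  (0 <= ordp p a ->
     2 * ordp p m%:~R <= ordp p (twist a m).1%:~R /\
     ordp p (twist a m).1%:~R <= 2 * ordp p m%:~R + 1) /\
  (ordp p a < 0 ->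
     3 * ordp p m%:~R <= ordp p (twist a m).2%:~R /\
     ordp p (twist a m).2%:~R <= 3 * ordp p m%:~R + 2).
Proof.
move=> a0 m0 pp; rewrite twistA // twistB // !ordp_scaled //.
by split=> [/alphap_ge0|/alphap_lt0]; lia.
Qed.

Theorem theorem2p7 (R : realType) (alpha beta X : R) (j : rat)
    (halpha : 1 <= alpha) (hbeta : 1 <= beta) (hX : 0 < X)
    (hj0 : j != 0) (hj1728 : j != 1728) :
  let Etj := height_le (with_j all_curves j) alpha beta X in
  let Ej := height_le (with_j min_curves j) alpha beta X in
  let bound : R := cj j alpha beta * X `^ (1 / 6) in
  (forall m : int, m != 0 ->
     (Aj j m)%:~R = Na (aj j) ^+ 2 * m%:~R ^+ 2 / aj j /\
     (Bj j m)%:~R = Na (aj j) ^+ 3 * m%:~R ^+ 3 / aj j) /\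
  Etj = [set curvej j m | m in
          [set m : int | m != 0 /\ `|m%:~R| <= bound]] /\
  (finite_set Etj /\ (#|` fset_set Etj|%fset)%:Z = 2 * Num.floor bound) /\
  (forall (m : int) (p : nat), m != 0 -> prime p ->
     (0 <= ordp p (aj j) ->
        2 * ordp p m%:~R <= ordp p (Aj j m)%:~R /\
        ordp p (Aj j m)%:~R <= 2 * ordp p m%:~R + 1) /\
     (ordp p (aj j) < 0 ->
        3 * ordp p m%:~R <= ordp p (Bj j m)%:~R /\
        ordp p (Bj j m)%:~R <= 3 * ordp p m%:~R + 2)) /\
  (forall m : int, m != 0 ->
     (Ej (curvej j m) <-> squarefree m /\ `|m%:~R| <= bound)) /\
  Ej = [set curvej j m | m in
         [set m : int | [/\ m != 0, squarefree m & `|m%:~R| <= bound]]].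
Proof.
move=> Etj Ej bound.
have a0 := aj_neq0 j hj0 hj1728.
have al0 : 0 < alpha := lt_le_trans ltr01 halpha.
have be0 : 0 < beta := lt_le_trans ltr01 hbeta.
have jP E := with_jP j E hj0 hj1728.
have bound_ge0 : 0 <= bound.
  have := ltW (Na_gt0 (aj j)); rewrite -(ler0q R); exact: min_root_ge0.
have AjE m : m != 0 -> (Aj j m)%:~R = Na (aj j) ^+ 2 * m%:~R ^+ 2 / aj j.
  exact: twistA.
have BjE m : m != 0 -> (Bj j m)%:~R = Na (aj j) ^+ 3 * m%:~R ^+ 3 / aj j.
  exact: twistB.
have wj m : m != 0 -> with_j all_curves j (curvej j m).
  by move=> m0; apply/jP; split; [exact: twistA_neq0|exact: twist_eq].
have wjm m : m != 0 -> with_j min_curves j (curvej j m) <-> squarefree m.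
  move=> m0; have [sf fs] := twist_min (aj j) m a0 m0; have [cE jE] := wj m m0.
  by split=> [[[_ nE] _]|m_sf]; [exact: sf nE|exact: (conj (conj cE (fs m_sf)) jE)].
have hE m : m != 0 -> (height alpha beta (curvej j m) <= X) = (`|m%:~R| <= bound).
  by move=> m0; exact: twist_height.
have surj E : with_j all_curves j E -> exists2 m : int, m != 0 & curvej j m = E.
  by move=> /jP[A0 BA]; exact: twist_surj.
have inj m n : m != 0 -> n != 0 -> curvej j m = curvej j n -> m = n.
  exact: twist_inj.
split; first by move=> m m0; exact: (conj (AjE m m0) (BjE m m0)).
have ord_bounds (m : int) (p : nat) : m != 0 -> prime p ->
     (0 <= ordp p (aj j) ->
        2 * ordp p m%:~R <= ordp p (Aj j m)%:~R /\
        ordp p (Aj j m)%:~R <= 2 * ordp p m%:~R + 1) /\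
     (ordp p (aj j) < 0 ->
        3 * ordp p m%:~R <= ordp p (Bj j m)%:~R /\
        ordp p (Bj j m)%:~R <= 3 * ordp p m%:~R + 2).
  by move=> m0 pp; exact: twist_ordp.
(* The set descriptions and the count are now formal consequences of membership, the minimality and
   height criteria, surjectivity and injectivity, so the bound and the parametrization become
   opaque. *)
clear AjE BjE a0 jP hj0 hj1728; clearbody bound.
move: (curvej j) wj wjm hE surj inj => c wj wjm hE surj inj.
have EtjE : Etj = [set c m | m in [set m : int | m != 0 /\ `|m%:~R| <= bound]].
  apply/seteqP; split=> [E [/surj[m m0 <-] hX']|_ [m [m0 mb] <-]].
    by exists m => //; split=> //; rewrite -(hE m m0).
  by split; [exact: wj|rewrite (hE m m0)].
have EjP m : m != 0 -> Ej (c m) <-> squarefree m /\ `|m%:~R| <= bound.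
  move=> m0; rewrite -(hE m m0); split=> -[].
    by move=> /(wjm m m0).
  by move=> /(wjm m m0).
split=> //; split; last split=> //; last split=> //.
  (* The real bound on |m| is replaced by its integer floor, whose nonnegativity lets [absz] be
     removed at the end. *)
  have [||fin ->] := @card_inj_nonzero curve c `|Num.floor bound|%N Etj.
  - by [].
  - by rewrite EtjE; congr image; apply/seteqP; split=> m /=; rewrite ler_absz_floor.
  by split=> //; move: bound_ge0; rewrite -floor_ge0; move: (Num.floor _) => n; lia.
apply/seteqP; split=> [E EE|_ [m [m0 sm mb] <-]]; last by apply/(EjP m m0).
have [m m0 mE] : exists2 m : int, m != 0 & c m = E.
  by case: EE => -[[cE _] jE] _; exact: surj (conj cE jE).
by exists m => //; move: EE; rewrite -mE => /(EjP m m0)[].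
Qed.
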